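(* For any graph $G$, $$T_G(1,2)=|\mathcal{C}(G)|,\qquad T_G(1,1)=|\mathcal{CF}(G)|,$$ where $\mathcal{C}(G)$ is the set of covering graphs of $G$ and $\mathcal{CF}(G)$ is the set of covering forests of $G$.
   Context: Graphs are finite and simple: $G=(V(G),E(G))$ with $E(G)$ a set of unordered pairs of distinct vertices; the empty graph is allowed. $\mathrm{cc}(G)$ is the number of connected components of $G$. For $F\subseteq E(G)$, $G_{\mid F}$ is the graph with vertex set $V(G)$ and edge set $F$. The Tutte polynomial is $T_G(X,Y)=\sum_{F\subseteq E(G)} (X-1)^{\mathrm{cc}(G_{\mid F})-\mathrm{cc}(G)} (Y-1)^{\mathrm{cc}(G_{\mid F})+|F|-|V(G)|}$, a polynomial over a field $\mathbb{K}$ of characteristic $0$. A covering graph of $G$ is a graph $H$ with $V(H)=V(G)$, $E(H)\subseteq E(G)$ and $\mathrm{cc}(H)=\mathrm{cc}(G)$. A covering forest of $G$ is a covering graph of $G$ which is a forest (has no cycle). *)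

(* Defs.v *)
From HB Require Import structures.
From mathcomp Require Import all_boot all_order all_algebra.

Set Implicit Arguments.
Unset Strict Implicit.
Unset Printing Implicit Defensive.

Import GRing.Theory.
Local Open Scope ring_scope.

(* The empty graph is the case of an empty V. *)
Record graph (V : finType) := Graph {
  edges : {set {set V}};
  _ : [forall e in edges, #|e| == 2] }.

HB.instance Definition _ (V : finType) := [isSub for @edges V].
HB.instance Definition _ (V : finType) := [Finite of graph V by <:].

Section Graphs.
Variable V : finType.
Implicit Types (G H : graph V) (F : {set {set V}}).

Lemma card_edge G e : e \in edges G -> #|e| = 2.
Proof. by case: G => E /= /forall_inP cardE /cardE/eqP. Qed.

Definition adj G : rel V := fun x y => [set x; y] \in edges G.

Lemma adj_sym G : symmetric (adj G).
Proof. by move=> x y; rewrite /adj setUC. Qed.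

Lemma adj_irr G : irreflexive (adj G).
Proof.
by move=> x; apply/negP => /card_edge; rewrite setUid cards1.
Qed.

Lemma adj_connect_sym G : connect_sym (adj G).
Proof. exact/sym_connect_sym/adj_sym. Qed.

Definition cc G : nat := n_comp (adj G) [set: V].

Lemma restrict_subproof G F : [forall e in edges G :&: F, #|e| == 2].
Proof. by apply/forall_inP => e /setIP[/card_edge->]. Qed.

(* Intersecting with [edges G] makes the operation total; it changes nothing
   when F is a subset of [edges G], see [edges_restrict]. *)
Definition restrict G F : graph V := Graph (restrict_subproof G F).

Lemma edges_restrict G F : F \subset edges G -> edges (restrict G F) = F.
Proof. exact/setIidPr. Qed.

Definition covering_graph G H : bool :=
  (edges H \subset edges G) && (cc H == cc G).

(* A cycle is a sequence of at least three distinct vertices, cyclically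
   adjacent. *)
Definition is_forest G : Prop :=
  forall c : seq V, (2 < size c)%N -> ~ ucycle (adj G) c.

(* Decision procedure for [is_forest], see [forestP]. *)
Definition forest G : bool :=
  [forall n : 'I_#|V|.+1, forall c : n.-tuple V,
     (2 < n)%N ==> ~~ (cycle (adj G) c && uniq c)].

Lemma forestP G : reflect (is_forest G) (forest G).
Proof.
apply: (iffP forallP) => [fG c c_gt2 /andP[cycc uc]|fG n].
  have ltc : (size c < #|V|.+1)%N by rewrite ltnS -(card_uniqP uc) max_card.
  have /forallP/(_ (in_tuple c)) := fG (Ordinal ltc).
  by rewrite /= c_gt2 cycc uc.
apply/forallP => c; apply/implyP => n_gt2; apply/negP => cycc.
by apply: (fG c) cycc; rewrite size_tuple.
Qed.

Definition covering_graphs G : {set graph V} := [set H | covering_graph G H].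

Definition covering_forests G : {set graph V} :=
  [set H | covering_graph G H && forest H].

(* 'X and 'Y are the two variables, with (u.[x, y]) substituting x for 'X and
   y for 'Y.  The two exponents are never negative for F a set of edges of G,
   so the subtractions on nat do not truncate. *)
Definition tutte (K : fieldType) G : {poly {poly K}} :=
  \sum_(F : {set {set V}} | F \subset edges G)
     ('X - 1) ^+ (cc (restrict G F) - cc G)
     * ('Y - 1) ^+ (cc (restrict G F) + #|F| - #|V|).

End Graphs.

Arguments tutte {V} K G.

(* Main.v *)
Require Import Defs.
From mathcomp Require Import all_boot all_order all_algebra.

Set Implicit Arguments.
Unset Strict Implicit.
Unset Printing Implicit Defensive.

Import GRing.Theory.
Local Open Scope ring_scope.

(** The first equality reads the monomials off at the point: since [0 ^+ 0 = 1],
    setting [X = 1] keeps exactly the edge sets [F] such that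
    [cc (restrict G F) <= cc G]; the reverse inequality always holds
    ([leq_cc_sub]), so these are the covering graphs, and setting [Y = 2] gives
    each of them weight 1.

    For the second one, setting [Y = 1] keeps moreover only the [F] with
    [cc (restrict G F) + #|F| <= #|V|], and these are the forests: in any graph,
    [#|V| <= cc G + #|edges G|], with equality iff the graph is a forest
    ([leqif_cc_forest]).  This is proved by adding edges one at a time.  A new
    edge joining two components decreases [cc] by one and creates no cycle, so
    that neither [cc G + #|edges G|] nor being a forest is affected; a new edge
    inside a component leaves [cc] unchanged, so that the inequality becomes
    strict, and closes a cycle ([n_comp_add_edge], [forest_add_edge]). *)

Local Open Scope nat_scope.

(** * Components and a new edge *)

(** The two relations have the same classes away from those of [x] and [y];
    on the union of the latter, [e] has one or two classes and [e'] has one. *)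
Lemma n_comp_add_edge (T : finType) (e e' : rel T) (x y : T) :
    connect_sym e -> connect_sym e' -> subrel e e' -> e' x y ->
    (forall u v, e' u v -> e u v \/ [set u; v] = [set x; y]) ->
  n_comp e T = n_comp e' T + ~~ connect e x y.
Proof.
move=> sym_e sym_e' see' e'xy e'P.
have sub_c: subrel (connect e) (connect e').
  by apply: connect_sub => u v /see'; apply: connect1.
have new_edge u v :
    [set u; v] = [set x; y] -> (u \in pred2 x y) && (v \in pred2 x y).
  move=> Euv.
  have: (u \in [set x; y]) && (v \in [set x; y]) by rewrite -Euv set21 set22.
  by rewrite !in_set2.
set a := closure e (pred2 x y).
have a_closed' : closed e' a.
  apply: (intro_closed sym_e') => u v /e'P[euv|/new_edge/andP[_ v_xy] _].
    by rewrite (closure_closed sym_e _ euv).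
  exact: mem_closure.
have eq_a : a =i closure e' (pred2 x y).
  move=> z; apply/idP/idP => [|] /pred0Pn[t /andP[/= czt t_xy]].
    by apply/pred0Pn; exists t; rewrite /= t_xy andbT; apply: sub_c.
  by rewrite (closed_connect a_closed' czt); apply: mem_closure.
have eq_conn z : z \notin a -> connect e z =1 connect e' z.
  move=> az w; apply/idP/idP => [/sub_c //|c'zw].
  have zclosed : closed e' (connect e z).
    apply: (intro_closed sym_e') => u v /e'P[euv|/new_edge/andP[u_xy _] zu].
      by move=> zu; apply: connect_trans zu (connect1 euv).
    by case/negP: az; apply/pred0Pn; exists u; apply/andP.
  by move: (closed_connect zclosed c'zw); rewrite !inE connect0.
have eq_out : n_comp e [predC a] = n_comp e' [predC a].
  apply: eq_card => z; rewrite !inE; apply: andb_id2r => /eq_conn Ez.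
  by rewrite /roots /fingraph.root (eq_pick Ez).
rewrite (n_compC a) [n_comp e' T](n_compC a) eq_out addnAC; congr (_ + _).
rewrite [n_comp e' a](eq_n_comp_r eq_a) (n_comp_closure2 sym_e').
by rewrite (connect1 e'xy) /a (n_comp_closure2 sym_e).
Qed.

Section Graphs.
Variable V : finType.
Implicit Types (G H : graph V) (F : {set {set V}}).

Lemma ccE G : cc G = n_comp (adj G) V.
Proof. by apply: eq_n_comp_r => x; rewrite inE. Qed.

(** Distinct components of [G] contain distinct components of [H]. *)
Lemma leq_cc_sub G H : edges H \subset edges G -> cc G <= cc H.
Proof.
move=> sHG; rewrite !ccE /n_comp_mem.
have sub_c: subrel (connect (adj H)) (connect (adj G)).
  by apply: connect_sub => x y /(subsetP sHG); apply: connect1.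
have inj_root : {in predI (roots (adj G)) V &, injective (fingraph.root (adj H))}.
  move=> x y; rewrite !inE !andbT => /eqP rx /eqP ry.
  move=> /eqP; rewrite (root_connect (@adj_connect_sym _ H)) => /sub_c.
  by rewrite -(root_connect (@adj_connect_sym _ G)) rx ry => /eqP.
rewrite -(card_in_image inj_root); apply/subset_leq_card/subsetP => r.
by case/imageP=> x _ ->; rewrite !inE andbT; apply/roots_root/adj_connect_sym.
Qed.

(** * Cycles and a new edge *)

(** When [x] and [y] are connected in [H], a simple path between them is closed
    into a cycle by the new edge.  Conversely, a cycle of [G] using the new edge
    can be rotated so as to start with this edge, and the rest of the cycle is
    then a path of [H] between [x] and [y]. *)
Lemma forest_add_edge G H (x y : V) :
    edges G = [set x; y] |: edges H -> [set x; y] \notin edges H ->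
  forest G = forest H && ~~ connect (adj H) x y.
Proof.
move=> EG xyH.
have GP u v : adj G u v = ([set u; v] == [set x; y]) || adj H u v.
  by rewrite /adj EG in_setU1.
have Gxy : adj G x y by rewrite GP eqxx.
have sHG : subrel (adj H) (adj G) by move=> u v; rewrite GP orbC => ->.
have x'y : x != y by apply/eqP => Exy; rewrite Exy adj_irr in Gxy.
apply/forestP/andP => [fG | [/forestP fH xyN] c c_gt2 Gc].
  split.
    apply/forestP => c c_gt2 /andP[Hc Uc]; apply: (fG c c_gt2).
    by rewrite /ucycle Uc (sub_cycle sHG).
  apply/negP => /connectP[p0 Hp0 Ey].
  case/shortenP: Hp0 Ey => p Hp Up _ Ey.
  apply: (fG (x :: p)); last first.
    by rewrite /ucycle Up andbT /= rcons_path (sub_path sHG) //= -Ey adj_sym.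
  (* A path of length at most 1 would force [x = y] or [xy] to be an edge of [H]. *)
  case: p Hp Ey {Up} => [_ /eqP|z [|//]] /=; first by rewrite eq_sym (negPf x'y).
  by rewrite andbT => Hxz Ey; rewrite -Ey in Hxz; rewrite /adj (negPf xyH) in Hxz.
have [Hc|] := boolP (cycle (adj H) c).
  by case/andP: Gc => _ Uc; apply: (fH c c_gt2); rewrite /ucycle Hc.
case/andP: (Gc) => cycc Uc.
case: (boolP [forall u, (u \in c) ==> adj H u (next c u)]).
  move/forall_inP => Hn /negP[]; exact: cycle_from_next.
rewrite negb_forall => /existsP[u]; rewrite negb_imply => /andP[cu nHu] _.
(* The step from [u] to its successor [v] is the new edge; the cycle is rotated
   to start there. *)
case: (rot_to cu) => i p Ep.
have Enext : next c u = next (u :: p) u by rewrite -Ep next_rot.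
have: adj G u (next c u) by apply: next_cycle.
rewrite GP (negPf nHu) orbF Enext => /eqP Euv.
move: c_gt2 Gc Euv; rewrite -(size_rot i) -(rot_ucycle i) Ep.
case: p {Ep Enext} => [|v [|w q]] //= _ /andP[/and3P[_ Gvw Gq]].
rewrite eqxx => /andP[u'p /andP[v'p _]] Euv.
have neq a b : v \notin [:: a; b] -> adj G a b -> adj H a b.
  rewrite GP => v'ab; case: eqP => // Eab.
  by move: (set22 u v); rewrite Euv -Eab in_set2 => vab; rewrite !inE vab in v'ab.
have Hvw : adj H v w.
  move: Gvw; rewrite GP; case: eqP => // Evw.
  by move: u'p (set21 u v); rewrite Euv -Evw !inE !negb_or => /and3P[/negPf-> /negPf->].
have Hq : path (adj H) w (rcons q u).
  apply: (sub_in_path (P := predC1 v)) Gq => [a b av bv|].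
    by apply: neq; rewrite !inE negb_or ![v == _]eq_sym; apply/andP.
  have u'v : u != v by move: u'p; rewrite inE negb_or => /andP[].
  apply/allP => z; rewrite -rcons_cons mem_rcons inE => /predU1P[-> //|zp] /=.
  by apply: contraNneq v'p => <-.
have cvu : connect (adj H) v u.
  by apply/connectP; exists (w :: rcons q u); rewrite /= ?Hvw ?last_rcons.
case/negP: xyN; move: (set21 x y) (set22 x y); rewrite -Euv !in_set2.
case/pred2P=> Ex /pred2P[] Ey; move: x'y cvu; rewrite {}Ex {}Ey ?eqxx //.
by rewrite adj_connect_sym.
Qed.

(** * The rank identity of forests *)

Lemma cc_edgeless G : edges G = set0 -> cc G = #|V|.
Proof.
move=> G0; rewrite ccE; apply: eq_card => x; rewrite !inE andbT.
rewrite /roots; have /connectP[[|y p] /= Gp ->] := connect_root (adj G) x; first exact: eqxx.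
by move: Gp; rewrite /adj G0 inE.
Qed.

Lemma forest_edgeless G : edges G = set0 -> forest G.
Proof.
move=> G0; apply/forestP => -[|x [|y c]] //= _ /andP[/andP[Gxy _] _].
by rewrite /adj G0 inE in Gxy.
Qed.

Lemma leqif_cc_forest G : #|V| <= cc G + #|edges G| ?= iff forest G.
Proof.
have [n] := ubnP #|edges G|; elim: n G => // n IHn G.
have [G0 _|[e Ge]] := set_0Vmem (edges G).
  by rewrite G0 cards0 addn0 cc_edgeless // forest_edgeless //; split; rewrite ?eqxx.
have /eqP/cards2P[x [y [x'y Ee]]] := card_edge Ge.
pose H := restrict G (edges G :\ e).
have EH : edges H = edges G :\ e by rewrite edges_restrict ?subsetDl.
have EG : edges G = [set x; y] |: edges H by rewrite EH -Ee setD1K.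
have xyH : [set x; y] \notin edges H by rewrite EH Ee !inE eqxx.
have cardG : #|edges G| = #|edges H|.+1 by rewrite EG cardsU1 xyH.
have EccH : cc H = cc G + ~~ connect (adj H) x y.
  rewrite !ccE; apply: n_comp_add_edge => [||u v|//|u v].
  - exact: adj_connect_sym.
  - exact: adj_connect_sym.
  - by rewrite /adj EG => Huv; apply: setU1r.
  - by rewrite /adj EG setU11.
  - by rewrite /adj EG => /setU1P[]; [right | left].
rewrite cardG ltnS => /IHn; rewrite EccH (forest_add_edge EG xyH).
case: connect; last by rewrite andbT addn1 addSnnS.
by rewrite addn0 andbF addnS => -[leV _]; apply/leqifP; rewrite ltnS.
Qed.

(** * Covering graphs as edge sets *)

(** The sum counts the covering graphs [H] of [G] satisfying [P] by
    their edge sets. *)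
Lemma sum_covering_graphs (R : nzSemiRingType) G (P : pred (graph V)) :
  (\sum_(F : {set {set V}} | F \subset edges G)
     ((cc (restrict G F) <= cc G)%N && P (restrict G F))%:R
   = #|[set H | covering_graph G H && P H]|%:R :> R)%R.
Proof.
rewrite -natr_sum -big_mkcondr sum1_card; congr (_%:R)%R.
rewrite -(card_imset _ (val_inj : injective (@edges V))).
apply: eq_card => F; rewrite unfold_in; apply/and3P/imsetP => [[sFG leF PF]|[H]].
  exists (restrict G F); last by rewrite edges_restrict.
  by rewrite inE PF /covering_graph eqn_leq leF leq_cc_sub edges_restrict ?sFG.
rewrite inE => /andP[/andP[sHG /eqP ccH] PH] ->.
have -> : restrict G (edges H) = H by apply: val_inj; apply: edges_restrict.
by rewrite ccH.
Qed.

Lemma tutte_eval (K : fieldType) G (x y : K) :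
  ((tutte K G).[x, y] = \sum_(F : {set {set V}} | F \subset edges G)
     (x - 1) ^+ (cc (restrict G F) - cc G)%N
     * (y - 1) ^+ (cc (restrict G F) + #|F| - #|V|)%N)%R.
Proof.
rewrite /tutte !horner_sum; apply: eq_bigr => F _.
by rewrite !hornerE.
Qed.

End Graphs.

Local Close Scope nat_scope.

Theorem proposition3p2 (K : fieldType) (charK0 : [pchar K] =i pred0)
    (V : finType) (G : graph V) :
  (tutte K G).[1, 2] = #|covering_graphs G|%:R /\
  (tutte K G).[1, 1] = #|covering_forests G|%:R.
Proof.
have y2 : 2 - 1 = 1 :> K by rewrite -[2]/(1 + 1) addrK.
rewrite !tutte_eval subrr y2; split.
  have -> : covering_graphs G = [set H | covering_graph G H && predT H].
    by apply/setP => H; rewrite !inE andbT.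
  rewrite -sum_covering_graphs; apply: eq_bigr => F _.
  by rewrite expr1n mulr1 expr0n subn_eq0 andbT.
rewrite -(sum_covering_graphs _ _ (@forest V)); apply: eq_bigr => F sFG.
have := geq_leqif (leqif_cc_forest (restrict G F)).
rewrite edges_restrict // => <-.
by rewrite !expr0n !subn_eq0 -natrM mulnb.
Qed.
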